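(* The class $\mathcal{M}$ is closed under multiplication: if $m_1, m_2\in\mathcal{M}$, then the pointwise product $m_1m_2$ belongs to $\mathcal{M}$.
   Context: $\mathcal{M}$ denotes the set of functions $m\in C^2[0,1]$ such that: (C1) $m(s)>0$ for $s>0$ and $m(0)=0$; (C2) $m'(s)>0$ for $s>0$ and $m'(0)=0$; (C3) $m''(s)>0$ for $s>0$; (C4) the function $\frac{m''}{m'}$ is decreasing on $(0,1)$. ''Decreasing'' means strictly decreasing. *)

(* Defs.v *)
From Stdlib Require Export Reals.
Open Scope R_scope.

Definition unit_interval (s : R) : Prop := 0 <= s <= 1.

(* [d] is the derivative on [D] of [f], all difference quotients being taken
   inside [D]: at the end points of an interval it is the one-sided one. *)
Definition derivative_on (D : R -> Prop) (f d : R -> R) : Prop :=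
  forall s, D s -> D_in f d D s.

Definition continuous_on (D : R -> Prop) (f : R -> R) : Prop :=
  forall s, D s -> continue_in f D s.

Definition strictly_decreasing_on (D : R -> Prop) (f : R -> R) : Prop :=
  forall s t, D s -> D t -> s < t -> f t < f s.

(* [m] is in C^2[0,1], with first and second derivatives [m'] and [m''] there.
   Only the values on [0,1] matter; they determine [m'] and [m''] on [0,1].
   Continuity of [m] and [m'] follows from differentiability. *)
Definition C2_01 (m m' m'' : R -> R) : Prop :=
  derivative_on unit_interval m m' /\
  derivative_on unit_interval m' m'' /\
  continuous_on unit_interval m''.

Definition class_M (m : R -> R) : Prop :=
  exists m' m'' : R -> R,
    C2_01 m m' m'' /\
    ((forall s, 0 < s <= 1 -> 0 < m s) /\ m 0 = 0) /\
    ((forall s, 0 < s <= 1 -> 0 < m' s) /\ m' 0 = 0) /\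
    (forall s, 0 < s <= 1 -> 0 < m'' s) /\
    strictly_decreasing_on (fun s => 0 < s < 1) (fun s => m'' s / m' s).

(* Main.v *)
Require Import Defs.
From Stdlib Require Import Reals Lra.
From Coquelicot Require Import Rcomplements.
Open Scope R_scope.

(** For [m] in the class put [p = m'' / m'] and [a = m' / m].  As [m'] and [m]
    vanish at [0], the monotone form of l'Hospital's rule turns "[p] decreases"
    into "[p < a] and [a] decreases".  For the product of two members with
    quotients [p, a] and [q, b], the quotient of (C4) is
    [F = (p a + q b + 2 a b) / (a + b)].  It increases in [p] and [q]; it
    increases in [a] because [p - q + 2 b > 0], and in [b] because
    [q - p + 2 a > 0].  All four arguments decrease, so [F] does. *)

Definition closed_interval (a b x : R) : Prop := a <= x <= b.

Definition open_interval (a b x : R) : Prop := a < x < b.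

Definition right_open_interval (a b x : R) : Prop := a <= x < b.

Lemma closed_interval_subset_right_open (a b s t : R) :
  a <= s -> t < b ->
  forall x, closed_interval s t x -> right_open_interval a b x.
Proof. unfold closed_interval, right_open_interval; intros; lra. Qed.

Lemma open_interval_subset (a b s t : R) :
  a <= s -> t <= b -> forall x, open_interval s t x -> open_interval a b x.
Proof. unfold open_interval; intros; lra. Qed.

Lemma continuous_on_subset (D E : R -> Prop) (f : R -> R) :
  (forall x, E x -> D x) -> continuous_on D f -> continuous_on E f.
Proof.
  intros sub hf x hx; apply (limit1_imp _ (D_x D x)).
  - intros y [hy ne]; split; auto.
  - apply hf; auto.
Qed.

Lemma continuous_on_plus (D : R -> Prop) (f g : R -> R) :
  continuous_on D f -> continuous_on D g -> continuous_on D (fun x => f x + g x).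
Proof. intros hf hg x hx; apply limit_plus; [apply hf | apply hg]; exact hx. Qed.

Lemma continuous_on_mult (D : R -> Prop) (f g : R -> R) :
  continuous_on D f -> continuous_on D g -> continuous_on D (fun x => f x * g x).
Proof. intros hf hg x hx; apply limit_mul; [apply hf | apply hg]; exact hx. Qed.

Lemma derivative_on_subset (D E : R -> Prop) (f d : R -> R) :
  (forall x, E x -> D x) -> derivative_on D f d -> derivative_on E f d.
Proof. intros sub hf x hx; apply (D_in_imp _ _ D); auto. Qed.

Lemma derivative_on_continuous_on (D : R -> Prop) (f d : R -> R) :
  derivative_on D f d -> continuous_on D f.
Proof. intros hf x hx; exact (cont_deriv _ _ _ _ (hf x hx)). Qed.

Lemma derivative_on_plus (D : R -> Prop) (f df g dg : R -> R) :
  derivative_on D f df -> derivative_on D g dg ->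
  derivative_on D (fun x => f x + g x) (fun x => df x + dg x).
Proof. intros hf hg x hx; apply Dadd; auto. Qed.

Lemma derivative_on_mult (D : R -> Prop) (f df g dg : R -> R) :
  derivative_on D f df -> derivative_on D g dg ->
  derivative_on D (fun x => f x * g x) (fun x => df x * g x + f x * dg x).
Proof. intros hf hg x hx; apply Dmult; auto. Qed.

Lemma derivative_on_open_interval_derivable (a b : R) (f d : R -> R) (x : R) :
  derivative_on (open_interval a b) f d -> a < x < b ->
  derivable_pt_lim f x (d x).
Proof.
  intros hf hx; apply derivable_pt_lim_D_in; intros eps heps.
  destruct (hf x hx eps heps) as [del [hdel hlim]].
  exists (Rmin del (Rmin (x - a) (b - x))); split.
  - repeat apply Rmin_pos; lra.
  - intros y [[_ ne] hy]; simpl in *; unfold Rdist in *.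
    apply Rmin_Rgt_l in hy as [hydel hy]; apply Rmin_Rgt_l in hy as [hya hyb].
    apply Rabs_def2 in hya; apply Rabs_def2 in hyb.
    apply hlim; split; [split|]; unfold open_interval; lra.
Qed.

Definition clamp (a b x : R) : R := Rmax a (Rmin b x).

Lemma clamp_in (a b x : R) : a <= b -> closed_interval a b (clamp a b x).
Proof.
  unfold clamp, closed_interval, Rmax, Rmin.
  destruct (Rle_dec b x), (Rle_dec a _); lra.
Qed.

Lemma clamp_id (a b x : R) : closed_interval a b x -> clamp a b x = x.
Proof.
  intros [hax hxb]; unfold clamp.
  rewrite (Rmin_right b x hxb); exact (Rmax_right a x hax).
Qed.

Lemma clamp_contract (a b x y : R) :
  Rabs (clamp a b x - clamp a b y) <= Rabs (x - y).
Proof.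
  unfold clamp, Rmax, Rmin, Rabs.
  destruct (Rle_dec b x), (Rle_dec b y); repeat destruct (Rle_dec a _);
    repeat destruct (Rcase_abs _); lra.
Qed.

Lemma continuity_clamp (a b : R) (f : R -> R) :
  a <= b -> continuous_on (closed_interval a b) f ->
  continuity (fun x => f (clamp a b x)).
Proof.
  intros hab hf x eps heps.
  destruct (hf _ (clamp_in a b x hab) eps heps) as [del [hdel hlim]].
  exists del; split; [exact hdel|].
  intros y [_ hy]; simpl in *; unfold Rdist in *.
  destruct (Req_dec (clamp a b x) (clamp a b y)) as [e|ne].
  - rewrite e, Rminus_diag, Rabs_R0; exact heps.
  - apply hlim; split; [split; [exact (clamp_in a b y hab) | exact ne]|].
    exact (Rle_lt_trans _ _ _ (clamp_contract a b y x) hy).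
Qed.

(* [MVT] asks for two-sided continuity at the end points; composing with
   [clamp] provides it without changing the functions on the interval. *)
Lemma Cauchy_MVT_on (a b : R) (f df g dg : R -> R) :
  a < b ->
  continuous_on (closed_interval a b) f -> derivative_on (open_interval a b) f df ->
  continuous_on (closed_interval a b) g -> derivative_on (open_interval a b) g dg ->
  exists c, a < c < b /\ (g b - g a) * df c = (f b - f a) * dg c.
Proof.
  intros hab fcont fder gcont gder.
  assert (clamp_derivable : forall h dh, derivative_on (open_interval a b) h dh ->
    forall c, a < c < b -> derivable_pt_lim (fun x => h (clamp a b x)) c (dh c)).
  { intros h dh hder c hc; apply (derivable_pt_lim_locally_ext h _ c a b _ hc).
    - intros z hz; rewrite clamp_id by (unfold closed_interval; lra); reflexivity.
    - exact (derivative_on_open_interval_derivable a b h dh c hder hc). }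
  destruct (MVT (fun x => f (clamp a b x)) (fun x => g (clamp a b x)) a b
    (fun c hc => exist _ (df c) (clamp_derivable f df fder c hc))
    (fun c hc => exist _ (dg c) (clamp_derivable g dg gder c hc)) hab)
    as [c [hc mean_value]].
  - intros c _; apply continuity_clamp; [lra | exact fcont].
  - intros c _; apply continuity_clamp; [lra | exact gcont].
  - exists c; split; [exact hc|]; simpl in mean_value.
    rewrite !clamp_id in mean_value by (unfold closed_interval; lra).
    exact mean_value.
Qed.

Lemma derivative_pos_lt (a b : R) (f df : R -> R) :
  a < b ->
  continuous_on (closed_interval a b) f -> derivative_on (open_interval a b) f df ->
  (forall x, a < x < b -> 0 < df x) -> f a < f b.
Proof.
  intros hab fcont fder df_pos.
  assert (idder : forall D, derivative_on D (fun x => x) (fun _ => 1)).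
  { intros D x _; apply Dx. }
  destruct (Cauchy_MVT_on a b f df _ _ hab fcont fder
    (derivative_on_continuous_on _ _ _ (idder _)) (idder _)) as [c [hc mean_value]].
  pose proof (proj2 (Rlt_0_minus a b) hab) as hba.
  pose proof (Rmult_lt_0_compat _ _ hba (df_pos c hc)); lra.
Qed.

Section MonotoneLHospital.

Variables (a b : R) (f df g dg : R -> R).
Hypothesis g_cont : continuous_on (right_open_interval a b) g.
Hypothesis g_der : derivative_on (open_interval a b) g dg.
Hypothesis dg_pos : forall x, open_interval a b x -> 0 < dg x.

Lemma lhospital_denominator_lt (s t : R) : a <= s -> s < t -> t < b -> g s < g t.
Proof.
  intros has hst htb.
  pose proof (closed_interval_subset_right_open a b s t has htb) as closed_sub.
  pose proof (open_interval_subset a b s t has (Rlt_le _ _ htb)) as open_sub.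
  apply (derivative_pos_lt s t g dg hst).
  - exact (continuous_on_subset _ _ _ closed_sub g_cont).
  - exact (derivative_on_subset _ _ _ _ open_sub g_der).
  - auto.
Qed.

Hypothesis g_a : g a = 0.

Lemma lhospital_denominator_pos (s : R) : open_interval a b s -> 0 < g s.
Proof. intros [has hsb]; rewrite <- g_a; apply lhospital_denominator_lt; lra. Qed.

Hypothesis f_cont : continuous_on (right_open_interval a b) f.
Hypothesis f_der : derivative_on (open_interval a b) f df.

Lemma Cauchy_MVT_quotient (s t : R) :
  a <= s -> s < t -> t < b ->
  exists c, s < c < t /\ f t - f s = df c / dg c * (g t - g s).
Proof.
  intros has hst htb.
  pose proof (closed_interval_subset_right_open a b s t has htb) as closed_sub.
  pose proof (open_interval_subset a b s t has (Rlt_le _ _ htb)) as open_sub.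
  destruct (Cauchy_MVT_on s t f df g dg hst
    (continuous_on_subset _ _ _ closed_sub f_cont)
    (derivative_on_subset _ _ _ _ open_sub f_der)
    (continuous_on_subset _ _ _ closed_sub g_cont)
    (derivative_on_subset _ _ _ _ open_sub g_der)) as [c [hc mean_value]].
  exists c; split; [exact hc|].
  assert (0 < dg c) by auto.
  apply (Rmult_eq_reg_r (dg c)); [|lra].
  rewrite <- mean_value; field; lra.
Qed.

Hypothesis f_a : f a = 0.
Hypothesis derivative_quotient_decreasing :
  strictly_decreasing_on (open_interval a b) (fun x => df x / dg x).

Lemma lhospital_derivative_quotient_lt (s : R) :
  open_interval a b s -> df s / dg s < f s / g s.
Proof.
  intros hs; pose proof hs as [has hsb].
  destruct (Cauchy_MVT_quotient a s) as [c [hc mean_value]]; try lra.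
  pose proof (lhospital_denominator_pos s hs) as gs_pos.
  rewrite f_a, g_a, !Rminus_0_r in mean_value.
  rewrite mean_value; unfold Rdiv at 2.
  rewrite Rmult_inv_r_id_l by lra.
  apply derivative_quotient_decreasing; unfold open_interval; lra.
Qed.

Lemma lhospital_decreasing :
  strictly_decreasing_on (open_interval a b) (fun x => f x / g x).
Proof.
  intros s t hs ht hst; pose proof hs as [has hsb]; pose proof ht as [_ htb].
  destruct (Cauchy_MVT_quotient s t) as [c [hc mean_value]]; try lra.
  assert (gst : g s < g t) by (apply lhospital_denominator_lt; lra).
  assert (slope_lt : df c / dg c < f s / g s).
  { apply Rlt_trans with (df s / dg s).
    - apply derivative_quotient_decreasing; unfold open_interval; lra.
    - exact (lhospital_derivative_quotient_lt s hs). }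
  pose proof (lhospital_denominator_pos s hs) as gs_pos.
  pose proof (lhospital_denominator_pos t ht) as gt_pos.
  assert (fs : f s = f s / g s * g s) by (field; lra).
  apply Rlt_div_l; [exact gt_pos|].
  pose proof (proj2 (Rlt_0_minus (g s) (g t)) gst) as gst_pos.
  pose proof (Rmult_lt_compat_r _ _ _ gst_pos slope_lt); lra.
Qed.

End MonotoneLHospital.

Definition log_derivative (f f' : R -> R) (s : R) : R := f' s / f s.

Definition decreasing_log_derivatives (D : R -> Prop) (m m' m'' : R -> R) : Prop :=
  (forall s, D s -> 0 < m s /\ 0 < m' s /\ 0 < m'' s) /\
  (forall s, D s -> log_derivative m' m'' s < log_derivative m m' s) /\
  strictly_decreasing_on D (log_derivative m m') /\
  strictly_decreasing_on D (log_derivative m' m'').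

Lemma C2_01_decreasing_log_derivatives (m m' m'' : R -> R) :
  C2_01 m m' m'' -> m 0 = 0 -> m' 0 = 0 ->
  (forall s, 0 < s < 1 -> 0 < m' s) -> (forall s, 0 < s < 1 -> 0 < m'' s) ->
  strictly_decreasing_on (open_interval 0 1) (log_derivative m' m'') ->
  decreasing_log_derivatives (open_interval 0 1) m m' m''.
Proof.
  intros (der & der' & _) m0 m'0 m'_pos m''_pos dec.
  assert (right_open_sub : forall s, right_open_interval 0 1 s -> unit_interval s)
    by (unfold right_open_interval, unit_interval; intros; lra).
  assert (open_sub : forall s, open_interval 0 1 s -> unit_interval s)
    by (unfold open_interval, unit_interval; intros; lra).
  pose proof (derivative_on_subset _ _ _ _ open_sub der) as open_der.
  pose proof (derivative_on_subset _ _ _ _ open_sub der') as open_der'.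
  pose proof (continuous_on_subset _ _ _ right_open_sub
    (derivative_on_continuous_on _ _ _ der)) as cont.
  pose proof (continuous_on_subset _ _ _ right_open_sub
    (derivative_on_continuous_on _ _ _ der')) as cont'.
  split; [|split; [|split]].
  - intros s hs; split; [|split]; auto.
    apply (lhospital_denominator_pos 0 1 m m'); auto.
  - intros s hs; apply (lhospital_derivative_quotient_lt 0 1 m' m'' m m'); auto.
  - apply (lhospital_decreasing 0 1 m' m'' m m'); auto.
  - exact dec.
Qed.

Definition mult_deriv (f f' g g' : R -> R) (s : R) : R := f' s * g s + f s * g' s.

Definition mult_deriv2 (f f' f'' g g' g'' : R -> R) (s : R) : R :=
  mult_deriv f' f'' g g' s + mult_deriv f f' g' g'' s.

Lemma C2_01_mult (f f' f'' g g' g'' : R -> R) :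
  C2_01 f f' f'' -> C2_01 g g' g'' ->
  C2_01 (fun s => f s * g s) (mult_deriv f f' g g')
    (mult_deriv2 f f' f'' g g' g'').
Proof.
  intros (df & df' & cf'') (dg & dg' & cg'').
  pose proof (derivative_on_continuous_on _ _ _ df).
  pose proof (derivative_on_continuous_on _ _ _ df').
  pose proof (derivative_on_continuous_on _ _ _ dg).
  pose proof (derivative_on_continuous_on _ _ _ dg').
  split; [|split].
  - apply derivative_on_mult; assumption.
  - apply derivative_on_plus; apply derivative_on_mult; assumption.
  - repeat apply continuous_on_plus; apply continuous_on_mult; assumption.
Qed.

Definition product_quotient (p a q b : R) : R :=
  (p * a + q * b + 2 * (a * b)) / (a + b).

Lemma log_derivative_mult_deriv (f f' f'' g g' g'' : R -> R) (s : R) :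
  0 < f s -> 0 < f' s -> 0 < g s -> 0 < g' s ->
  log_derivative (mult_deriv f f' g g') (mult_deriv2 f f' f'' g g' g'') s =
  product_quotient (log_derivative f' f'' s) (log_derivative f f' s)
    (log_derivative g' g'' s) (log_derivative g g' s).
Proof.
  intros f_pos f'_pos g_pos g'_pos.
  assert (0 < f' s * g s) by (apply Rmult_lt_0_compat; assumption).
  assert (0 < f s * g' s) by (apply Rmult_lt_0_compat; assumption).
  unfold log_derivative, product_quotient, mult_deriv2, mult_deriv.
  field; repeat split; lra.
Qed.

Lemma product_quotient_sym (p a q b : R) :
  product_quotient p a q b = product_quotient q b p a.
Proof. unfold product_quotient; f_equal; ring. Qed.

Lemma product_quotient_incr_p (p1 p2 a q b : R) :
  0 < a -> 0 < b -> p1 < p2 ->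
  product_quotient p1 a q b < product_quotient p2 a q b.
Proof.
  intros ha hb hp; unfold product_quotient, Rdiv.
  apply Rmult_lt_compat_r; [apply Rinv_0_lt_compat; lra|].
  pose proof (Rmult_lt_compat_r a p1 p2 ha hp); lra.
Qed.

Lemma product_quotient_incr_a (p a1 a2 q b : R) :
  0 < a1 -> 0 < b -> q < p + 2 * b -> a1 < a2 ->
  product_quotient p a1 q b < product_quotient p a2 q b.
Proof.
  intros ha hb hq ha12; apply Rminus_lt_0; unfold product_quotient.
  replace (_ - _) with
    ((a2 - a1) * (b * (p - q + 2 * b)) / ((a2 + b) * (a1 + b))) by (field; lra).
  apply Rdiv_lt_0_compat; repeat apply Rmult_lt_0_compat; lra.
Qed.

Lemma product_quotient_incr (p1 p2 a1 a2 q1 q2 b1 b2 : R) :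
  0 < p1 < a1 -> 0 < q1 < b1 -> p1 < p2 -> a1 < a2 -> q1 < q2 -> b1 < b2 ->
  product_quotient p1 a1 q1 b1 < product_quotient p2 a2 q2 b2.
Proof.
  intros hp hq p12 a12 q12 b12.
  apply Rlt_trans with (product_quotient p1 a2 q1 b1).
  { apply product_quotient_incr_a; lra. }
  apply Rlt_trans with (product_quotient p1 a2 q1 b2).
  { rewrite !(product_quotient_sym p1); apply product_quotient_incr_a; lra. }
  apply Rlt_trans with (product_quotient p2 a2 q1 b2).
  { apply product_quotient_incr_p; lra. }
  rewrite !(product_quotient_sym p2); apply product_quotient_incr_p; lra.
Qed.

Lemma log_derivative_mult_deriv_decreasing (D : R -> Prop)
  (f f' f'' g g' g'' : R -> R) :
  decreasing_log_derivatives D f f' f'' -> decreasing_log_derivatives D g g' g'' ->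
  strictly_decreasing_on D
    (log_derivative (mult_deriv f f' g g') (mult_deriv2 f f' f'' g g' g'')).
Proof.
  intros (f_pos & f_lt & f_dec & f'_dec) (g_pos & g_lt & g_dec & g'_dec) s t hs ht hst.
  rewrite !log_derivative_mult_deriv by (apply f_pos || apply g_pos; assumption).
  apply product_quotient_incr; auto.
  - split; [apply Rdiv_lt_0_compat; apply f_pos | apply f_lt]; exact ht.
  - split; [apply Rdiv_lt_0_compat; apply g_pos | apply g_lt]; exact ht.
Qed.

Theorem corollary1 (m1 m2 : R -> R) (hm1 : class_M m1) (hm2 : class_M m2) :
  class_M (fun s => m1 s * m2 s).
Proof.
  destruct hm1 as (f' & f'' & fC2 & (f_pos & f0) & (f'_pos & f'0) & f''_pos & f_dec).
  destruct hm2 as (g' & g'' & gC2 & (g_pos & g0) & (g'_pos & g'0) & g''_pos & g_dec).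
  exists (mult_deriv m1 f' m2 g'), (mult_deriv2 m1 f' f'' m2 g' g'').
  split; [|split; [split|split; [split|split]]].
  - apply C2_01_mult; assumption.
  - intros s hs; apply Rmult_lt_0_compat; auto.
  - rewrite f0; ring.
  - intros s hs; apply Rplus_lt_0_compat; apply Rmult_lt_0_compat; auto.
  - unfold mult_deriv; rewrite f0, g0; ring.
  - intros s hs; repeat apply Rplus_lt_0_compat; apply Rmult_lt_0_compat; auto.
  - assert (sub : forall s, 0 < s < 1 -> 0 < s <= 1) by (intros; lra).
    apply log_derivative_mult_deriv_decreasing;
      apply C2_01_decreasing_log_derivatives; auto.
Qed.
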